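(* Let $m_1,m_2,k_0$ be integers with $m_1\ge 0$ and $m_2\ge k_0\ge 0$. If $G$ is an $(m_1+2m_2)$-tree-connected graph, then the edge set of $G$ can be decomposed into two factors $G_1$ and $G_2$ such that $G_1$ is $m_1$-tree-connected, $G_2[X,Y]$ is $m_2$-tree-connected for some partition $X,Y$ of $V(G)$, and $$e_{G_2}(X)+e_{G_2}(Y)= \min\{k_0, bi(G)\}.$$
   Context: Graphs may have loops and multiple edges. A factor is a spanning subgraph. A graph is $m$-tree-connected if it contains $m$ edge-disjoint spanning trees. For $A\subseteq V(G)$, $e_G(A)$ is the number of edges with both ends in $A$. For a partition $X,Y$ of the vertex set, $G_2[X,Y]$ denotes the spanning bipartite subgraph of $G_2$ consisting of the edges with one end in $X$ and the other in $Y$. The bipartite index $bi(G)$ is the minimum of $|E(G)\setminus E(H)|$ over all bipartite factors $H$ of $G$. *)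

(* Defs.v *)
From mathcomp Require Import all_boot.

Set Implicit Arguments.
Unset Strict Implicit.
Unset Printing Implicit Defensive.

(* Finite graphs with loops and multiple edges. The order in which the two
   ends of an edge are listed is never used: see [joins]. *)
Record multigraph := Multigraph {
  vertex : finType;
  edge : finType;
  end1 : edge -> vertex;
  end2 : edge -> vertex
}.

(* A factor (spanning subgraph) of G has all the vertices of G, hence is
   represented by its edge set F : {set edge G}; G itself is [set: edge G]. *)
Section Factors.
Variable G : multigraph.
Implicit Types (e : edge G) (x y : vertex G) (F : {set edge G}).
Implicit Types (X Y A : {set vertex G}).

Definition joins e x y : bool :=
  ((end1 e == x) && (end2 e == y)) || ((end1 e == y) && (end2 e == x)).

Definition adjacent F : rel (vertex G) :=
  [rel x y | [exists e in F, joins e x y]].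

Definition connected_factor F : Prop :=
  forall x y, connect (adjacent F) x y.

(* The cycle v_0 e_0 v_1 e_1 ... v_(k-1) e_(k-1) v_0 is listed as the sequence
   of the pairs (v_i, e_i); k = 1 is a loop, k = 2 a pair of parallel edges. *)
Definition is_cycle F (c : seq (vertex G * edge G)) : Prop :=
  [/\ c != [::],
      uniq (unzip1 c),
      uniq (unzip2 c),
      {subset unzip2 c <= F}
    & cycle (fun p q => joins p.2 p.1 q.1) c].

Definition acyclic F : Prop := forall c, ~ is_cycle F c.

Definition spanning_tree F : Prop := connected_factor F /\ acyclic F.

Definition tree_connected (m : nat) F : Prop :=
  exists T : 'I_m -> {set edge G},
    [/\ forall i, T i \subset F,
        forall i, spanning_tree (T i)
      & forall i j, i != j -> [disjoint T i & T j]].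

Definition edges_within F A : nat :=
  #|[set e in F | (end1 e \in A) && (end2 e \in A)]|.

(* A part may be empty, as is unavoidable when G has a single vertex. *)
Definition bipartition X Y : bool :=
  (X :|: Y == [set: vertex G]) && [disjoint X & Y].

Definition crossing e X Y : bool :=
  ((end1 e \in X) && (end2 e \in Y)) || ((end1 e \in Y) && (end2 e \in X)).

Definition bipartite_part F X Y : {set edge G} :=
  [set e in F | crossing e X Y].

Definition bipartite F : bool :=
  [exists X : {set vertex G}, exists Y : {set vertex G},
     bipartition X Y && [forall e in F, crossing e X Y]].

Lemma bipartite0 : bipartite set0.
Proof.
apply/existsP; exists setT; apply/existsP; exists set0.
rewrite /bipartition setU0 eqxx disjoint_sym disjoints_subset sub0set /=.
by apply/forall_inP => e; rewrite inE.
Qed.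

End Factors.

(* The empty factor is bipartite (lemma [bipartite0]), so it is a legitimate
   starting point for the minimum; [bi_index_attained] and [bi_index_min] are
   the defining properties. *)
Definition bi_index (G : multigraph) : nat :=
  #|~: [arg min_(H < (set0 : {set edge G}) | bipartite H) #|~: H|]|.

Lemma bi_index_attained (G : multigraph) :
  exists2 H : {set edge G}, bipartite H & #|~: H| = bi_index G.
Proof.
rewrite /bi_index; case: arg_minnP => [|H bH _]; first exact: bipartite0.
by exists H.
Qed.

Lemma bi_index_min (G : multigraph) (H : {set edge G}) :
  bipartite H -> bi_index G <= #|~: H|.
Proof.
rewrite /bi_index; case: arg_minnP => [|K _ minK]; first exact: bipartite0.
exact: minK.
Qed.

(* Main.v *)
Require Import Defs.
From HB Require Import structures.
From mathcomp Require Import all_boot all_algebra zify.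

(* Let H be the edge set of a maximum cut (X, ~X), let S be a set of
   min(k0, bi(G)) edges outside H, and let n be the number of vertices.  It
   suffices to find m1 spanning trees in ~S and m2 spanning trees in H, all
   edge-disjoint.  By matroid union they exist as soon as every edge set K
   satisfies m1 a + m2 b <= |~K|, where a and b are the codimensions
   (n - 1 - rank) of K \ S and of K :&: H in the graphic matroid.
   - If b < 2a, the m1 + 2 m2 trees of G give
     (m1 + 2 m2) a <= |~(K \ S)| <= |~K| + m2, which is enough.
   - If 2a <= b, then (m1 + 2 m2) b <= 2 |H \ K| is enough.  The trees of G give
     (m1 + 2 m2) b <= e(P), where e(P) counts the edges between different
     components of K :&: H, and at least half of these edges lie in H: switching
     sides on one component does not enlarge the cut; sum over the components.
   Matroid union is obtained by Rado's shrinking argument, and the graphic rank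
   is the dimension of the span of the edge vectors over F_2, which makes its
   submodularity the dimension formula for subspaces. *)

Import GRing.Theory.

Set Implicit Arguments.
Unset Strict Implicit.
Unset Printing Implicit Defensive.

(** * Matroid union through shrinking *)

Section Rado.
Variables (E I : finType) (r : I -> {set E} -> nat).
Hypothesis r0 : forall i, r i set0 = 0.
Hypothesis rS : forall i (A B : {set E}), A \subset B -> r i A <= r i B.
Hypothesis r_submod : forall i (A B : {set E}),
  r i (A :|: B) + r i (A :&: B) <= r i A + r i B.

(** Think of [e] as the set of its copies [(e, i)] with [i \in D e]; [spread D] is then Rado's
    condition for an independent transversal of these sets in the direct sum of the [r i]. *)
Let part (D : {ffun E -> {set I}}) i (K : {set E}) : {set E} :=
  [set e in K | i \in D e].

Let spread D := forall K : {set E}, #|K| <= \sum_i r i (part D i K).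

(* Deleting either of two indices from [D e] can only fail on sets [K1], [K2]
   containing [e]; submodularity on [K1 :|: K2] and [(K1 :&: K2) :\ e] rules
   out that both fail. *)
Lemma spread_shrink D e i j :
    spread D -> i \in D e -> j \in D e -> i != j ->
  exists2 D', spread D' & \sum_x #|D' x| < \sum_x #|D x|.
Proof.
move=> spD iDe jDe nij.
pose rmv l := [ffun x => if x == e then D x :\ l else D x] : {ffun E -> {set I}}.
have rmv_lt l : l \in D e -> \sum_x #|rmv l x| < \sum_x #|D x|.
  move=> lDe; rewrite (bigD1 e) //= [ltnRHS](bigD1 e) //= ffunE eqxx.
  rewrite [in ltnRHS](cardsD1 l) lDe -addnA add1n ltnS leq_add2l.
  by apply: leq_sum => x /negPf xe; rewrite ffunE xe.
have bad l : l \in D e -> (exists2 D', spread D' & \sum_x #|D' x| < \sum_x #|D x|)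
    \/ exists K : {set E}, \sum_i r i (part (rmv l) i K) < #|K|.
  move=> lDe.
  have [/forallP ok|] :=
    boolP [forall K : {set E}, #|K| <= \sum_i r i (part (rmv l) i K)].
    by left; exists (rmv l); last exact: rmv_lt.
  by rewrite negb_forall => /existsP [K]; rewrite -ltnNge; right; exists K.
case: (bad i iDe) => [//|[K1 ltK1]]; case: (bad j jDe) => [//|[K2 ltK2]].
have in_bad l K : \sum_i r i (part (rmv l) i K) < #|K| -> e \in K.
  move=> ltK; apply/negPn/negP => eK; move: ltK; rewrite ltnNge => /negP[].
  apply: leq_trans (spD K) _; apply: leq_sum => k _; apply: rS.
  apply/subsetP => x; rewrite !inE ffunE => /andP[xK kD]; rewrite xK.
  by case: eqP => // xe; rewrite -xe xK in eK.
have eK1 := in_bad _ _ ltK1; have eK2 := in_bad _ _ ltK2.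
(* The left side is [#|K1| + #|K2| - 1], while both sums on the right are strictly too small, which
   makes them at most [#|K1| + #|K2| - 2] together. *)
suff: #|K1 :|: K2| + #|(K1 :&: K2) :\ e| <=
    \sum_l r l (part (rmv i) l K1) + \sum_l r l (part (rmv j) l K2).
  have := cardsUI K1 K2; rewrite [#|_ :&: _|](cardsD1 e) inE eK1 eK2 /=; lia.
apply: leq_trans (leq_add (spD _) (spD _)) _.
rewrite -!big_split /=; apply: leq_sum => l _.
apply: leq_trans (r_submod l _ _); apply: leq_add; apply: rS; apply/subsetP => x.
  rewrite !inE !ffunE; case: eqP => [->|_]; last first.
    by case/andP=> /orP[] -> ->; rewrite ?orbT.
  (* Since [i != j], an index [l] of [e] survives in [rmv i] or in [rmv j]. *)
  rewrite eK1 eK2 /= !inE => ->; rewrite !andbT.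
  by case: eqP => // ->; rewrite nij.
by rewrite !inE !ffunE; case: eqP => //= _ /andP[/andP[-> ->] ->].
Qed.

(** Shrink from [D e = setT] until each [D e] has at most one index. [spread] on singletons forbids
    empty [D e], and on a fiber of [f] only one summand is nonzero. *)
Lemma rado_partition :
    (forall K : {set E}, #|K| <= \sum_i r i K) ->
  exists f : E -> I, forall i, #|[set e | f e == i]| <= r i [set e | f e == i].
Proof.
move=> spT.
have [D spD D1] : exists2 D, spread D & forall e, #|D e| <= 1.
  have [D0 spD0] : exists D, spread D.
    exists [ffun=> setT] => K; apply: leq_trans (spT K) _.
    apply: leq_sum => i _; apply: rS.
    by apply/subsetP => x; rewrite !inE ffunE inE => ->.
  have [n] := ubnP (\sum_x #|D0 x|); elim: n D0 spD0 => // n IHn D spD ltDn.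
  have [/forallP|] := boolP [forall e, #|D e| <= 1]; first by exists D.
  rewrite negb_forall => /existsP [e].
  rewrite -ltnNge => /card_gt1P [i [j [iD jD nij]]].
  have [D' spD' ltD'] := spread_shrink spD iD jD nij.
  by apply: (IHn D' spD'); apply: leq_trans ltD' _.
have De e : {i | D e == [set i]}.
  apply: sigW; have/cards1P[] : #|D e| == 1; last by move=> i ->; exists i.
  rewrite eqn_leq D1 /=.
  have: 0 < \sum_i r i (part D i [set e])
    by apply: leq_trans (spD [set e]); rewrite cards1.
  rewrite lt0n; apply: contraNT; rewrite -eqn0Ngt cards_eq0 => /eqP D0.
  apply/eqP; apply: big1 => i _; rewrite -(r0 i); congr r; apply/setP => x.
  by rewrite !inE; case: eqP => // ->; rewrite D0 inE.
exists (fun e => sval (De e)) => i; set J := [set e | _].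
have DJ e l : l \in D e -> sval (De e) = l.
  by case: (De e) => k /= /eqP ->; rewrite inE => /eqP.
apply: leq_trans (spD J) _; rewrite (bigD1 i) //= big1 ?addn0 => [|l nli].
  by apply: rS; apply/subsetP => x; rewrite inE => /andP[].
rewrite -(r0 l); congr r; apply/setP => x; rewrite !inE.
by apply/andP => -[/eqP xi /DJ xl]; rewrite -xl xi eqxx in nli.
Qed.
End Rado.

(** * The graphic matroid over F_2 *)

Section Rank.
Variable G : multigraph.
Implicit Types (e : edge G) (u v w : vertex G) (A B F K : {set edge G}).
Implicit Types (C X : {set vertex G}).
Local Open Scope ring_scope.

Local Notation space := {ffun vertex G -> ('F_2)^o}.

Definition vertex_vec u : space := [ffun w => (w == u)%:R].
Definition edge_vec e : space := vertex_vec (end1 e) + vertex_vec (end2 e).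
Definition edge_space F : {vspace space} := (\sum_(e in F) <[edge_vec e]>)%VS.
Definition graph_rank F : nat := \dim (edge_space F).

Lemma space_addvv (x : space) : x + x = 0.
Proof. by apply/ffunP => w; rewrite !ffunE; apply: addrr_pchar2; apply: pchar_Fp. Qed.

Lemma dim_space : \dim {: space} = #|vertex G|.
Proof. by rewrite dimvf /dim /= /dim /= muln1. Qed.

Lemma edge_vec_joins e u v : joins e u v -> edge_vec e = vertex_vec u + vertex_vec v.
Proof. by case/orP=> /andP[/eqP<- /eqP<-] //; rewrite addrC. Qed.

Lemma mem_edge_space F e : e \in F -> edge_vec e \in edge_space F.
Proof. by move=> eF; rewrite memvE; apply: (sumv_sup e). Qed.

Lemma edge_spaceP F (U : {vspace space}) :
  reflect (forall e, e \in F -> edge_vec e \in U) (edge_space F <= U)%VS.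
Proof. exact: subv_sumP. Qed.

Lemma edge_spaceS A B : A \subset B -> (edge_space A <= edge_space B)%VS.
Proof.
by move=> sAB; apply/edge_spaceP => e eA; apply/mem_edge_space/(subsetP sAB).
Qed.

Lemma graph_rankS A B : A \subset B -> (graph_rank A <= graph_rank B)%N.
Proof. by move=> sAB; apply/dimvS/edge_spaceS. Qed.

Lemma graph_rank0 : graph_rank set0 = 0%N.
Proof. by rewrite /graph_rank /edge_space big_set0 dimv0. Qed.

Lemma graph_rank_card F : (graph_rank F <= #|F|)%N.
Proof.
apply: leq_trans (dimv_leq_sum _ _ _) _; rewrite -sum1_card.
by apply: leq_sum => e _; rewrite dim_vline leq_b1.
Qed.

Lemma graph_rank_submod A B :
  (graph_rank (A :|: B) + graph_rank (A :&: B) <= graph_rank A + graph_rank B)%N.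
Proof.
rewrite /graph_rank -(dimv_sum_cap (edge_space A)) leq_add // dimvS //.
  apply/edge_spaceP => e /setUP[] eAB; apply: (subvP _ _ (mem_edge_space eAB)).
    exact: addvSl.
  exact: addvSr.
by rewrite subv_cap !edge_spaceS ?subsetIl ?subsetIr.
Qed.

Lemma connect_edge_space F u v :
  connect (adjacent F) u v -> vertex_vec u + vertex_vec v \in edge_space F.
Proof.
case/connectP=> p; elim: p u => [|w p IHp] u /= => [_ ->|/andP[uw pth] lst].
  by rewrite space_addvv mem0v.
case/exists_inP: uw => e eF /edge_vec_joins euw.
have := memvD (mem_edge_space eF) (IHp _ pth lst).
by rewrite euw addrA -(addrA (vertex_vec u)) space_addvv addr0.
Qed.

(** This functional vanishes on every edge that does not cross [C], so it detects vectors outside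
    [edge_space F]. *)
Definition mass C (x : space) : ('F_2)^o := \sum_(w in C) x w.

Lemma mass_is_linear C : linear (mass C).
Proof.
move=> a x y; rewrite /mass scaler_sumr -big_split /=.
by apply: eq_bigr => w _; rewrite !ffunE.
Qed.
HB.instance Definition _ C :=
  GRing.isLinear.Build _ _ _ _ (mass C) (mass_is_linear C).

Lemma mass_vertex C u : mass C (vertex_vec u) = (u \in C)%:R.
Proof.
rewrite /mass (eq_bigr (fun w => (w == u)%:R)) => [|w _]; last by rewrite ffunE.
case: (boolP (u \in C)) => uC; last first.
  by apply: big1 => w wC; case: eqP wC uC => // -> ->.
rewrite (bigD1 u) //= eqxx big1 ?addr0 // => w /andP[_ /negPf ->] //.
Qed.

Lemma mass_edge_space F C (x : space) :
    (forall e, e \in F -> (end1 e \in C) = (end2 e \in C)) ->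
  x \in edge_space F -> mass C x = 0.
Proof.
move=> CF; suff /subvP sub : (edge_space F <= lker (linfun (mass C)))%VS.
  by move/sub; rewrite memv_ker lfunE => /eqP.
apply/edge_spaceP => e eF; rewrite memv_ker lfunE /= linearD /= !mass_vertex.
by rewrite (CF e eF) addrr_pchar2 //; apply: pchar_Fp.
Qed.

(** The total mass is 0 on edge vectors and 1 on [vertex_vec v]. *)
Lemma dim_edge_space_vertex F v : \dim (edge_space F + <[vertex_vec v]>) = (graph_rank F).+1.
Proof.
rewrite dimv_disjoint_sum ?dim_vline.
  suff -> : vertex_vec v != 0 by rewrite addn1.
  apply/eqP => v0; have /esym/eqP := mass_vertex setT v.
  by rewrite v0 linear0 inE oner_eq0.
apply/eqP; rewrite -subv0; apply/subvP => x /memv_capP [xF /vlineP [a xa]].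
have := mass_edge_space (C := setT) (fun e _ => etrans (in_setT _) (esym (in_setT _))) xF.
by rewrite xa linearZ /= mass_vertex inE [_ *: _]mulr1 => ->; rewrite scale0r memv0.
Qed.

Lemma graph_rank_max F : (graph_rank F <= #|vertex G|.-1)%N.
Proof.
have := dimvS (subvf (edge_space F)); rewrite dim_space -/(graph_rank F).
case: (pickP (mem [set: vertex G])) => [v _ _|V0].
  have := dimvS (subvf (edge_space F + <[vertex_vec v]>)).
  by rewrite dim_space dim_edge_space_vertex; lia.
by rewrite -cardsT (eq_card0 V0).
Qed.

Lemma graph_rank_connected F : connected_factor F -> graph_rank F = #|vertex G|.-1.
Proof.
move=> cF; apply/eqP; rewrite eqn_leq graph_rank_max /=.
case: (pickP (mem [set: vertex G])) => [v _|V0]; last by rewrite -cardsT (eq_card0 V0).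
suff: (fullv <= edge_space F + <[vertex_vec v]>)%VS.
  by move/dimvS; rewrite dim_space dim_edge_space_vertex -subn1 leq_subLR add1n.
apply/subvP => x _.
have -> : x = \sum_w x w *: vertex_vec w.
  apply/ffunP => w; rewrite sum_ffunE (bigD1 w) //= big1 => [|z /negPf nz].
    by rewrite !ffunE eqxx addr0 [RHS]mulr1.
  by rewrite !ffunE eq_sym nz [LHS]mulr0.
apply: memv_suml => w _; apply: memvZ.
have -> : vertex_vec w = vertex_vec w + vertex_vec v + vertex_vec v.
  by rewrite -addrA space_addvv addr0.
by apply: memv_add; rewrite ?memv_line // connect_edge_space.
Qed.

Lemma adjacent_sym F : symmetric (adjacent F).
Proof.
by move=> u v; apply: eq_existsb => e; rewrite /joins orbC.
Qed.

Lemma connect_adjacent_sym F : connect_sym (adjacent F).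
Proof. exact/sym_connect_sym/adjacent_sym. Qed.

Lemma adjacent_ends F e : e \in F -> adjacent F (end1 e) (end2 e).
Proof. by move=> eF; apply/exists_inP; exists e; rewrite // /joins !eqxx. Qed.

(** At full rank, [vertex_vec u] lies in the edge space plus the line of [vertex_vec v]. If [v] were
    outside the component of [u], the mass on that component would be 1 on [u] but 0 on this sum. *)
Lemma connected_of_rank F : graph_rank F = #|vertex G|.-1 -> connected_factor F.
Proof.
move=> rF u v; apply/negPn/negP => nuv.
have full : (edge_space F + <[vertex_vec v]>)%VS = fullv.
  apply/eqP; rewrite eqEdim subvf dim_space dim_edge_space_vertex rF prednK ?leqnn //.
  by apply/card_gt0P; exists u.
have /memv_addP[x xF [_ /vlineP[a ->] def_u]] :
    vertex_vec u \in (edge_space F + <[vertex_vec v]>)%VS.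
  by rewrite full memvf.
have massE C : (forall e, e \in F -> (end1 e \in C) = (end2 e \in C)) ->
    (u \in C)%:R = a * (v \in C)%:R.
  move=> CF; rewrite -!mass_vertex def_u linearD /= (mass_edge_space CF xF) add0r.
  by rewrite linearZ.
suff /massE/eqP : forall e, e \in F ->
    (end1 e \in [set w | connect (adjacent F) u w]) =
    (end2 e \in [set w | connect (adjacent F) u w]).
  by rewrite !inE connect0 (negPf nuv) mulr0 oner_eq0.
move=> e eF; rewrite !inE; apply: same_connect_r; last exact/connect1/adjacent_ends.
exact: connect_adjacent_sym.
Qed.

(** The edge vectors telescope. The path stops at the vertex of [q], so in [cycle_edge_space] the
    edge of [q] can be the removed one. *)
Lemma path_edge_space F (p q : vertex G * edge G) s :
    path (fun p q => joins p.2 p.1 q.1) p (rcons s q) ->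
    {subset unzip2 (p :: s) <= F} ->
  vertex_vec p.1 + vertex_vec q.1 \in edge_space F.
Proof.
elim: s p => [|z s IHs] p /=.
  rewrite andbT => /edge_vec_joins <- sF; apply/mem_edge_space/sF.
  by rewrite inE eqxx.
case/andP=> /edge_vec_joins pz pth sF.
have pF : p.2 \in F by apply: sF; rewrite inE eqxx.
have := memvD (mem_edge_space pF) (IHs _ pth _).
rewrite pz addrA -(addrA (vertex_vec p.1)) space_addvv addr0; apply.
by move=> e ze; apply: sF; rewrite inE ze orbT.
Qed.

Lemma cycle_edge_space F c : is_cycle F c ->
  exists2 e, e \in F & edge_vec e \in edge_space (F :\ e).
Proof.
case: c => [|[v e] c] [] //= _ _ /andP[ec _] sF cyc.
have eF : e \in F by apply: sF; rewrite inE eqxx.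
exists e => //; case: c ec sF cyc => [|q c] /= ec sF.
  by rewrite andbT => /edge_vec_joins ->; rewrite space_addvv mem0v.
case/andP=> /edge_vec_joins /= -> pth; rewrite addrC.
apply: (path_edge_space (q := (v, e)) pth) => x xc; rewrite !inE.
have -> : x \in F by apply: sF; rewrite in_cons xc orbT.
by rewrite andbT; apply: contraNneq ec => <-.
Qed.

(** Deleting an edge of a cycle keeps the rank, which would then be below [#|F|]. *)
Lemma acyclic_of_rank F : (#|F| <= graph_rank F)%N -> acyclic F.
Proof.
move=> cF c /cycle_edge_space [e eF eS].
have: (graph_rank F <= graph_rank (F :\ e))%N.
  apply/dimvS/edge_spaceP => x xF; case: (eqVneq x e) => [->//|xe].
  by apply: mem_edge_space; rewrite !inE xe.
have := graph_rank_card (F :\ e); rewrite [#|F|](cardsD1 e) eF in cF.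
lia.
Qed.

End Rank.

Lemma sum_card_fiber (E I : finType) (f : E -> I) : \sum_i #|[set e | f e == i]| = #|E|.
Proof.
rewrite -sum1_card (partition_big f xpredT) //=; apply: eq_bigr => i _.
by rewrite -sum1_card; apply: eq_bigl => e; rewrite inE.
Qed.

Lemma sum_option (I : finType) (F : option I -> nat) :
  \sum_o F o = F None + \sum_i F (Some i).
Proof.
rewrite (bigD1 None) //=; congr (_ + _).
by rewrite (reindex_omap Some id) => [|[]//]; apply: eq_bigl => i; rewrite eqxx.
Qed.

Lemma subset_of_card (E : finType) (A : {set E}) k :
  k <= #|A| -> exists2 S : {set E}, S \subset A & #|S| = k.
Proof.
rewrite -bin_gt0 -cards_draws => /card_gt0P [S]; rewrite inE => /andP[SA /eqP].
by exists S.
Qed.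

(** * Tree packing, and maximum cuts *)

Section Packing.
Variable G : multigraph.
Implicit Types (A B F K : {set edge G}) (C X : {set vertex G}).

(** The classes given by [rado_partition] have at most [n] edges each, and at most [d] for [None];
    as these bounds add up to [#|edge G|], all are attained. *)
Lemma tree_packing (I : finType) (L : I -> {set edge G}) :
    (forall K, #|I| * #|vertex G|.-1 <= \sum_i graph_rank (K :&: L i) + #|~: K|) ->
  exists T : I -> {set edge G},
    [/\ forall i, T i \subset L i, forall i, spanning_tree (T i)
      & forall i j, i != j -> [disjoint T i & T j]].
Proof.
set n := _.-1 => cond.
pose d := #|edge G| - #|I| * n.
(* The index [None] carries the uniform matroid of rank [d], which absorbs the
   edges that no tree uses. *)
pose r (o : option I) K := if o is Some i then graph_rank (K :&: L i) else minn #|K| d.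
have [|o A B sAB|o A B|K|f fP] := @rado_partition _ _ r.
- by case=> [i|] /=; rewrite ?set0I ?graph_rank0 // cards0 min0n.
- case: o => [i|] /=; first exact/graph_rankS/setSI.
  by have := subset_leq_card sAB; lia.
- case: o => [i|] /=; first by rewrite setIUl setIIl graph_rank_submod.
  by have := cardsUI A B; have := subset_leq_card (subsetIl A B);
     have := subset_leq_card (subsetIr A B); lia.
- rewrite sum_option /=; have := cond K; have := cardsC K; lia.
pose T i := [set e | f e == Some i].
have TL i : T i \subset L i.
  have /= := fP (Some i); rewrite -/(T i) => Ti.
  have := leq_trans Ti (graph_rank_card _).
  by move=> h; apply/setIidPl/eqP; rewrite eqEcard subsetIl.
have Tr i : #|T i| <= graph_rank (T i).
  by have /= := fP (Some i); rewrite (setIidPl (TL i)).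
have Tn i : graph_rank (T i) = n.
  have le j : j \in I -> graph_rank (T j) <= n ?= iff (graph_rank (T j) == n).
    by split; first exact: graph_rank_max.
  have [_] := leqif_sum le; rewrite sum_nat_const.
  suff -> : \sum_(j in I) graph_rank (T j) == #|I| * n.
    by move/esym/forallP/(_ i)/eqP.
  rewrite eqn_leq; apply/andP; split.
    by rewrite -sum_nat_const; apply: leq_sum => j _; apply: graph_rank_max.
  (* The subtraction defining [d] is therefore not truncated. *)
  have cE : #|I| * n <= #|edge G|.
    have := cond set0; rewrite setC0 cardsT big1 => // j _.
    by rewrite set0I graph_rank0.
  apply: (@leq_trans (\sum_j #|T j|)); last by apply: leq_sum.
  rewrite -(leq_add2l d) {1}/d subnK // -(sum_card_fiber f) sum_option leq_add2r.
  exact: leq_trans (fP None) (geq_minr _ _).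
exists T; split=> // [i|i j nij].
  by split; [apply: connected_of_rank | apply: acyclic_of_rank].
rewrite -setI_eq0; apply/eqP/setP => e; rewrite !inE.
by apply/andP => -[/eqP ->] /eqP[/eqP]; rewrite (negPf nij).
Qed.

(** Each spanning tree needs at least [n - 1 - rank A] edges outside [A], where [n] counts the
    vertices, and the trees are disjoint. *)
Lemma tree_connected_codim m A :
    tree_connected m [set: edge G] ->
  m * (#|vertex G|.-1 - graph_rank A) <= #|~: A|.
Proof.
case=> T [_ treeT disT].
have {disT} : \sum_i #|T i :\: A| <= #|~: A|.
  under eq_bigr do rewrite -sum1_card.
  rewrite -partition_disjoint_bigcup => [|i j nij].
    by rewrite sum1_card; apply/subset_leq_card/bigcupsP => i _; rewrite setDE subsetIr.
  apply: disjointWl (subsetDl _ _) _.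
  exact: disjointWr (subsetDl _ _) (disT _ _ nij).
apply: leq_trans; rewrite -[m in leqLHS]card_ord -sum_nat_const.
apply: leq_sum => i _; rewrite leq_subLR -(graph_rank_connected (treeT i).1).
have := graph_rank_submod A (T i :\: A); have := graph_rank_card (T i :\: A).
have : graph_rank (T i) <= graph_rank (A :|: T i :\: A).
  by apply/graph_rankS/subsetP => e; rewrite !inE => ->; rewrite andbT orbN.
lia.
Qed.

Definition cut X : {set edge G} := [set e | (end1 e \in X) != (end2 e \in X)].

Lemma bipartite_cut X : bipartite (cut X).
Proof.
apply/existsP; exists X; apply/existsP; exists (~: X); apply/andP; split.
  by rewrite /bipartition setUCr eqxx -setI_eq0 setICr eqxx.
apply/forall_inP => e; rewrite /crossing !inE.
by case: (_ \in X); case: (_ \in X).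
Qed.

Definition max_cut X := forall C, #|cut C| <= #|cut X|.

Lemma bi_index_cut : exists2 X, max_cut X & #|~: cut X| = bi_index G.
Proof.
have [H bH cH] := bi_index_attained G.
case/existsP: bH => X /existsP [Y /andP[/andP[_ dXY] /forall_inP HXY]].
have cX : #|~: cut X| = bi_index G.
  apply/eqP; rewrite eqn_leq bi_index_min ?bipartite_cut // andbT -cH.
  apply/subset_leq_card; rewrite setCS; apply/subsetP => e /HXY.
  rewrite inE /crossing => /orP[] /andP[e1 e2].
    by rewrite e1 (disjointFl dXY e2).
  by rewrite e2 (disjointFl dXY e1).
exists X => // C; have := bi_index_min (bipartite_cut C).
rewrite -cX; have := cardsC (cut C); have := cardsC (cut X); lia.
Qed.

(* Switching sides on [C] cannot enlarge the cut. *)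
Lemma max_cut_switch X C : max_cut X -> #|cut C :\: cut X| <= #|cut C :&: cut X|.
Proof.
move=> /(_ [set w | (w \in X) (+) (w \in C)]).
have -> : cut [set w | (w \in X) (+) (w \in C)] =
    (cut X :\: cut C) :|: (cut C :\: cut X).
  apply/setP => e; rewrite !inE.
  by do !case: (_ \in _).
rewrite cardsU disjoint_setI0 ?cards0; last first.
  by rewrite -setI_eq0; apply/eqP/setP => e; rewrite !inE; do !case: (_ \in _).
rewrite -(cardsID (cut C) (cut X)) setIC; lia.
Qed.

(** Double counting: an edge between two fibers is cut by exactly those two. *)
Lemma sum_cut_fiber (f : vertex G -> vertex G) A :
  \sum_c #|cut [set w | f w == c] :&: A| =
    2 * #|[set e in A | f (end1 e) != f (end2 e)]|.
Proof.
transitivity (\sum_c \sum_(e in A) (e \in cut [set w | f w == c])).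
  apply: eq_bigr => c _; rewrite -sum1_card [RHS]big_mkcond [LHS]big_mkcond /=.
  by apply: eq_bigr => e _; rewrite inE andbC; case: (e \in A).
rewrite exchange_big /= -sum1_card big_distrr /= big_mkcond [RHS]big_mkcond /=.
apply: eq_bigr => e _; rewrite inE; case: (e \in A) => //=.
have [fe|nf] := eqVneq; first by apply: big1 => c _; rewrite !inE fe eqxx.
rewrite (bigD1 (f (end1 e))) //= (bigD1 (f (end2 e))) 1?eq_sym //= !inE !eqxx.
rewrite [f (end2 e) == _]eq_sym (negPf nf) big1 // => c /andP[c1 c2].
by rewrite !inE ![_ == c]eq_sym (negPf c1) (negPf c2).
Qed.

Lemma max_cut_fibers X (f : vertex G -> vertex G)
    (N := [set e | f (end1 e) != f (end2 e)]) :
  max_cut X -> #|N :\: cut X| <= #|N :&: cut X|.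
Proof.
move=> maxX; rewrite -(leq_pmul2l (isT : 0 < 2)).
have NE A : N :&: A = [set e in A | f (end1 e) != f (end2 e)].
  by apply/setP => e; rewrite !inE andbC.
rewrite setDE !NE -!sum_cut_fiber; apply: leq_sum => c _.
by rewrite -setDE; apply: max_cut_switch.
Qed.

(** The closure of [F] in the graphic matroid; its complement consists of the edges between
    different components, which are the fibers of [fingraph.root]. *)
Definition edge_closure F : {set edge G} :=
  [set e | connect (adjacent F) (end1 e) (end2 e)].

Lemma sub_edge_closure F : F \subset edge_closure F.
Proof. by apply/subsetP => e eF; rewrite inE connect1 ?adjacent_ends. Qed.

Lemma graph_rank_closure F : graph_rank (edge_closure F) <= graph_rank F.
Proof.
by apply/dimvS/edge_spaceP => e; rewrite inE => /connect_edge_space.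
Qed.

Lemma max_cut_codim m X F :
    max_cut X -> tree_connected m [set: edge G] ->
  m * (#|vertex G|.-1 - graph_rank F) <= 2 * #|cut X :\: F|.
Proof.
move=> maxX /(tree_connected_codim (edge_closure F)) tc.
have le : m * (#|vertex G|.-1 - graph_rank F) <= #|~: edge_closure F|.
  apply: leq_trans tc; rewrite leq_mul2l leq_sub2l ?orbT //.
  exact: graph_rank_closure.
have := max_cut_fibers (fingraph.root (adjacent F)) maxX; set N := [set e | _].
have NE : ~: edge_closure F = N.
  by apply/setP => e; rewrite !inE root_connect //; apply: connect_adjacent_sym.
have : #|N :&: cut X| <= #|cut X :\: F|.
  apply/subset_leq_card; rewrite setIC setDE setIS // -NE setCS.
  exact: sub_edge_closure.
by move: le; rewrite NE -(cardsID (cut X) N); lia.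
Qed.

End Packing.

Theorem theorem7p2 (G : multigraph) (m1 m2 k0 : nat) :
  k0 <= m2 ->
  tree_connected (m1 + 2 * m2) [set: edge G] ->
  exists G1 G2 : {set edge G},
    [/\ G1 :|: G2 = [set: edge G],
        [disjoint G1 & G2],
        tree_connected m1 G1
      & exists X Y : {set vertex G},
          [/\ bipartition X Y,
              tree_connected m2 (bipartite_part G2 X Y)
            & edges_within G2 X + edges_within G2 Y = minn k0 (bi_index G)]].
Proof.
move=> k0m2 tcG; have [X maxX biX] := bi_index_cut G.
have [S SX cS] : exists2 S : {set edge G},
    S \subset ~: cut X & #|S| = minn k0 (bi_index G).
  by apply: subset_of_card; rewrite biX geq_minr.
(* [S] is reserved for the edges of the second factor inside [X] or inside [~: X]. *)
pose L (i : 'I_m1 + 'I_m2) := if i is inl _ then ~: S else cut X.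
have [K|T [TL treeT disT]] := @tree_packing G _ L.
  rewrite card_sum !card_ord big_sumType /= !sum_nat_const !card_ord -setDE.
  set n := _.-1; set k := #|~: K|.
  have ha : (m1 + 2 * m2) * (n - graph_rank (K :\: S)) <= k + m2.
    apply: leq_trans (tree_connected_codim _ tcG) _.
    rewrite setCD; apply: leq_trans (leq_card_setU _ _) _.
    by rewrite -/k cS; lia.
  have hb : (m1 + 2 * m2) * (n - graph_rank (K :&: cut X)) <= 2 * k.
    apply: leq_trans (max_cut_codim _ maxX tcG) _.
    rewrite leq_mul2l /=; apply/subset_leq_card/subsetP => e.
    by rewrite !inE => /andP[]; case: (e \in K) => //= /negPf->.
  have := graph_rank_max (K :\: S); have := graph_rank_max (K :&: cut X).
  move: ha hb; rewrite -/n.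
  move: (graph_rank (K :\: S)) (graph_rank (K :&: cut X)) => r1 r2.
  move=> ha hb r2n r1n.
  have [a0 na] : {a0 | n = a0 + r1} by exists (n - r1); rewrite subnK.
  have [b0 nb] : {b0 | n = b0 + r2} by exists (n - r2); rewrite subnK.
  move: ha hb; rewrite {1}na {1}nb !addnK => ha hb.
  suff : m1 * a0 + m2 * b0 <= k.
    by rewrite mulnDl {1}na nb !mulnDr; lia.
  move: ha hb; rewrite !mulnDl => ha hb.
  have [ab|ba] := leqP (2 * a0) b0.
    by have := leq_mul (leqnn m1) ab; lia.
  (* The strict inequality [b0 < 2 * a0] gains the [m2] that [ha] loses to [S]. *)
  by have := leq_mul (leqnn m2) ba; lia.
(* All edges outside both the cut and [S] go to [G1], so the non-cut edges of [~: G1] are exactly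
   those of [S]. *)
pose G1 := (\bigcup_i T (inl i)) :|: (~: cut X :\: S).
exists G1, (~: G1); split.
- by rewrite setUCr.
- by rewrite -setI_eq0 setICr.
- exists (fun i => T (inl i)); split=> // [i|i j nij].
    by apply: subset_trans (subsetUl _ _); apply: (bigcup_sup i).
  by apply: disT; rewrite (inj_eq inl_inj).
have crossE e : crossing e X (~: X) = (e \in cut X).
  by rewrite /crossing !inE; case: (end1 e \in X); case: (end2 e \in X).
exists X, (~: X); split.
- by rewrite /bipartition setUCr eqxx -setI_eq0 setICr /=.
- exists (fun i => T (inr i)); split=> // [i|i j nij]; last first.
    by apply: disT; rewrite (inj_eq inr_inj).
  apply/subsetP => e eT; have eX : e \in cut X := subsetP (TL (inr i)) e eT.
  rewrite inE crossE eX andbT in_setC in_setU in_setD in_setC eX andbF orbF.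
  apply/bigcupP => -[j _ eTj].
  by have := disT (inl j) (inr i) isT; move/disjointFr/(_ eTj); rewrite eT.
rewrite -cS /edges_within -cardsUI [X in _ + X]eq_card0 ?addn0 => [|e]; last first.
  by rewrite !inE; case: (end1 e \in X); rewrite /= ?andbF.
congr #|pred_of_set _|; apply/setP => e.
have -> : (e \in S) = (e \notin G1) && (e \notin cut X).
  rewrite /G1 in_setU in_setD in_setC.
  have [eS|eS] := boolP (e \in S); last by case: (e \in cut X); rewrite ?andbF ?orbT.
  have -> : e \in cut X = false by apply/negbTE; have := subsetP SX e eS; rewrite inE.
  rewrite orbF andbT; apply/esym/bigcupP => -[i _ eT].
  by have := subsetP (TL (inl i)) e eT; rewrite inE eS.
rewrite inE !in_setU !in_set.
by case: (end1 e \in X); case: (end2 e \in X); rewrite /= ?andbT ?andbF ?orbF.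
Qed.
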